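(* Let $S_\Delta=\Delta/\Gamma_\Delta$ be a spinor Abelian variety for $\mathbb{C}_q(V)$, with spinor representation $\rho:\mathbb{C}_q(V)\to\operatorname{End}(\Delta)$ and Clifford multiplication $\hat\rho:\mathbb{C}_q(V)_{\mathbb{Z}}\to\operatorname{End}(S_\Delta)$. Then the analytic representation $\tau_a:\operatorname{End}(S_\Delta)\to\operatorname{End}(\Delta)$ satisfies $\tau_a(\hat\rho(h))=\rho(h)$ for any $h\in\mathbb{C}_q(V)_{\mathbb{Z}}$.
   Context: Clifford algebra. $(V,q)$ is a nondegenerate real quadratic space of dimension $2k$, with a fixed orthonormal basis $e_1,\dots,e_{2k}$ (pairwise orthogonal, $q(e_j)=\pm1$). $C_q(V)$ is the quotient of the tensor algebra by the two-sided ideal generated by $v\otimes v-q(v)1$, and $\mathbb{C}_q(V)=C_q(V)\otimes_{\mathbb{R}}\mathbb{C}$. For $I=\{j_1<\dots<j_r\}\subset\{1,\dots,2k\}$, $e_I=e_{j_1}\cdots e_{j_r}$ ($e_\emptyset=1$). The integer subring $\mathbb{C}_q(V)_{\mathbb{Z}}=C_q(V)_{\mathbb{Z}}\otimes_{\mathbb{Z}}\mathbb{Z}[i]$ is the $\mathbb{Z}[i]$-span of all the $e_I$. Unitary spinor module. Fix an involution $*$ on $\mathbb{C}_q(V)$ with $(uv)^*=v^*u^*$ and $(cu)^*=\bar c u^*$ for $c\in\mathbb{C}$. A unitary spinor module is a finite-dimensional $\mathbb{Z}_2$-graded complex vector space $\Delta$ with a positive definite Hermitian form $H$ and an isomorphism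 of algebras $\rho:\mathbb{C}_q(V)\to\operatorname{End}_{\mathbb{C}}(\Delta)$ such that $\rho(g^* )$ is the $H$-adjoint of $\rho(g)$ for all $g$; $\dim_{\mathbb{C}}\Delta=2^k$. Spinor torus and spinor Abelian variety. A spinor torus is $S_\Delta=\Delta/\Gamma_\Delta$ with $\Gamma_\Delta\subset\Delta$ a full rank lattice satisfying $\rho(h)\Gamma_\Delta\subset\Gamma_\Delta$ for all $h\in\mathbb{C}_q(V)_{\mathbb{Z}}$. Clifford multiplication on $S_\Delta$ is the induced ring homomorphism $\hat\rho:\mathbb{C}_q(V)_{\mathbb{Z}}\to\operatorname{End}(S_\Delta)$, where $\hat\rho(h)$ is the endomorphism of $S_\Delta$ induced by $\rho(h)$. $S_\Delta$ is a spinor Abelian variety if moreover $H$ defines a principal polarization on $S_\Delta$: $\operatorname{Im}H$ is integer-valued on $\Gamma_\Delta\times\Gamma_\Delta$ and has determinant $1$ there. Analytic representation. Every endomorphism $f$ (holomorphic group homomorphism) of a complex torus $W/\Gamma$ is induced by a unique $\mathbb{C}$-linear map $f_a:W\to W$ with $f_a(\Gamma)\subset\Gamma$; $\tau_a(f)=f_a$. *)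

(* Defs.v *)
From HB Require Import structures.
From mathcomp Require Import all_boot all_order all_algebra.
From mathcomp Require Import complex sesquilinear ring_quotient generic_quotient.
From mathcomp Require Import finmap monalg.
From mathcomp Require Import boolp classical_sets functions reals topology normedtype.
From mathcomp Require Import derive.

Set Implicit Arguments.
Unset Strict Implicit.
Unset Printing Implicit Defensive.

Import Order.TTheory GRing.Theory Num.Theory.
Import numFieldNormedType.Exports VectorInternalTheory.

Local Open Scope ring_scope.
Local Open Scope quotient_scope.
Local Open Scope classical_set_scope.
Local Open Scope complex_scope.

(* The quotient by an arbitrary ideal may be the zero ring, so it is a        *)
(* [pzRingType] and an [lmodType] but in general not an [algType].            *)
Section AlgebraQuotient.
Context {R : pzRingType} {A : algType R}.
Implicit Types (I S : set A).

Definition two_sided_ideal I :=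
  [/\ I 0, (forall x y, I x -> I y -> I (x - y)),
      (forall a x, I x -> I (a * x)) & (forall a x, I x -> I (x * a))].

Definition generated_ideal S : set A :=
  [set x | forall I, two_sided_ideal I -> S `<=` I -> I x].

Lemma generated_ideal_ideal S : two_sided_ideal (generated_ideal S).
Proof.
split=> [I [] //|x y Ix Iy I II SI|a x Ix I II SI|a x Ix I II SI];
  case: (II) => I0 IB Il Ir.
- by apply: IB; [apply: Ix|apply: Iy].
- by apply: Il; apply: Ix.
- by apply: Ir; apply: Ix.
Qed.

Definition ideal_pred S : {pred A} := fun x => `[< generated_ideal S x >].

Lemma ideal_predP S x : reflect (generated_ideal S x) (x \in ideal_pred S).
Proof. exact: asboolP. Qed.

Fact ideal_pred_zmod S : zmod_closed (ideal_pred S).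
Proof.
have [I0 IB _ _] := generated_ideal_ideal S.
split=> [|x y /ideal_predP xI /ideal_predP yI]; apply/ideal_predP => //.
exact: IB.
Qed.

HB.instance Definition _ S :=
  GRing.isZmodClosed.Build A (ideal_pred S) (ideal_pred_zmod S).

Definition alg_quot S : Type := Quotient.quot (ideal_pred S).

Variable S : set A.
Local Notation Q := (alg_quot S).

HB.instance Definition _ := EqQuotient.on Q.
HB.instance Definition _ := GRing.Zmodule.on Q.

Definition alg_quot_pi (x : A) : Q := \pi_(alg_quot S) x.
Local Notation pi := alg_quot_pi.

Lemma alg_quot_piE x y : pi x = pi y <-> generated_ideal S (x - y).
Proof.
split=> [/eqmodP|Ixy]; first by rewrite /= /Quotient.equiv => /ideal_predP.
by apply/eqmodP; rewrite /= /Quotient.equiv; apply/ideal_predP.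
Qed.

Lemma alg_quot_ind (P : Q -> Prop) : (forall x, P (pi x)) -> forall u, P u.
Proof. by move=> Ppi; elim/quotW => x; apply: Ppi. Qed.

Lemma alg_quot_reprK u : pi (repr u) = u.
Proof. exact: reprK. Qed.

Lemma alg_quot_piD : {morph pi : x y / x + y}.
Proof. by move=> x y; rewrite /alg_quot_pi !piE. Qed.

Lemma alg_quot_pi0 : pi 0 = 0.
Proof. by rewrite /alg_quot_pi !piE. Qed.

Definition alg_quot_one : Q := pi 1.
Definition alg_quot_mul (u v : Q) : Q := pi (repr u * repr v).
Definition alg_quot_scale (c : R) (u : Q) : Q := pi (c *: repr u).

Lemma alg_quot_piM x y : alg_quot_mul (pi x) (pi y) = pi (x * y).
Proof.
have [_ IB Il Ir] := generated_ideal_ideal S.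
have /alg_quot_piE Hx := alg_quot_reprK (pi x).
have /alg_quot_piE Hy := alg_quot_reprK (pi y).
apply/alg_quot_piE; set a := repr _ in Hx *; set b := repr _ in Hy *.
have -> : a * b - x * y = (a - x) * b - (- x) * (b - y).
  by rewrite mulrBl mulNr opprK mulrBr addrA addrNK.
by apply: IB; [apply: Ir|apply: Il].
Qed.

Lemma alg_quot_piZ c x : alg_quot_scale c (pi x) = pi (c *: x).
Proof.
have [_ IB Il Ir] := generated_ideal_ideal S.
have /alg_quot_piE Hx := alg_quot_reprK (pi x).
apply/alg_quot_piE; rewrite -scalerBr -[X in c *: X]mul1r scalerAl.
exact: Il.
Qed.

Fact alg_quot_mulA : associative alg_quot_mul.
Proof.
elim/alg_quot_ind => x; elim/alg_quot_ind => y; elim/alg_quot_ind => z.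
by rewrite !alg_quot_piM mulrA.
Qed.
Fact alg_quot_mul1l : left_id alg_quot_one alg_quot_mul.
Proof. by elim/alg_quot_ind => x; rewrite alg_quot_piM mul1r. Qed.
Fact alg_quot_mul1r : right_id alg_quot_one alg_quot_mul.
Proof. by elim/alg_quot_ind => x; rewrite alg_quot_piM mulr1. Qed.
Fact alg_quot_mulDl : left_distributive alg_quot_mul +%R.
Proof.
elim/alg_quot_ind => x; elim/alg_quot_ind => y; elim/alg_quot_ind => z.
by rewrite -alg_quot_piD !alg_quot_piM mulrDl alg_quot_piD.
Qed.
Fact alg_quot_mulDr : right_distributive alg_quot_mul +%R.
Proof.
elim/alg_quot_ind => x; elim/alg_quot_ind => y; elim/alg_quot_ind => z.
by rewrite -alg_quot_piD !alg_quot_piM mulrDr alg_quot_piD.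
Qed.

HB.instance Definition _ := GRing.Zmodule_isPzRing.Build Q
  alg_quot_mulA alg_quot_mul1l alg_quot_mul1r alg_quot_mulDl alg_quot_mulDr.

Fact alg_quot_scaleA a b u :
  alg_quot_scale a (alg_quot_scale b u) = alg_quot_scale (a * b) u.
Proof. by elim/alg_quot_ind: u => x; rewrite !alg_quot_piZ scalerA. Qed.
Fact alg_quot_scale1 : left_id 1 alg_quot_scale.
Proof. by elim/alg_quot_ind => x; rewrite alg_quot_piZ scale1r. Qed.
Fact alg_quot_scaleDr : right_distributive alg_quot_scale +%R.
Proof.
move=> c; elim/alg_quot_ind => x; elim/alg_quot_ind => y.
by rewrite -alg_quot_piD !alg_quot_piZ scalerDr alg_quot_piD.
Qed.
Fact alg_quot_scaleDl u : {morph alg_quot_scale^~ u : a b / a + b}.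
Proof.
by move=> a b; elim/alg_quot_ind: u => x; rewrite !alg_quot_piZ scalerDl alg_quot_piD.
Qed.

HB.instance Definition _ := GRing.Zmodule_isLmodule.Build R Q
  alg_quot_scaleA alg_quot_scale1 alg_quot_scaleDr alg_quot_scaleDl.

Fact alg_quot_scalerAl (c : R) (u v : Q) : c *: (u * v) = (c *: u) * v.
Proof.
elim/alg_quot_ind: u => x; elim/alg_quot_ind: v => y.
change (alg_quot_scale c (alg_quot_mul (pi x) (pi y)) =
        alg_quot_mul (alg_quot_scale c (pi x)) (pi y)).
by rewrite alg_quot_piM !alg_quot_piZ alg_quot_piM scalerAl.
Qed.
Fact alg_quot_scalerAr (c : R) (u v : Q) : c *: (u * v) = u * (c *: v).
Proof.
elim/alg_quot_ind: u => x; elim/alg_quot_ind: v => y.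
change (alg_quot_scale c (alg_quot_mul (pi x) (pi y)) =
        alg_quot_mul (pi x) (alg_quot_scale c (pi y))).
by rewrite alg_quot_piM !alg_quot_piZ alg_quot_piM scalerAr.
Qed.

End AlgebraQuotient.

Fact addr_aux1 (M : zmodType) (x y z w : M) : x - y - (z + w) = x - w - (y + z).
Proof. by rewrite !opprD !addrA addrAC [x - w - y]addrAC [LHS]addrAC [RHS]addrAC. Qed.

Fact addr_aux2 (M : zmodType) (x y z w : M) : x + y + (z - w) = x - w + (y + z).
Proof. by rewrite [z - w]addrC addrACA. Qed.

(* A tensored with the complex numbers over the reals, i.e. A + iA: the pair  *)
(* (x, y) stands for x + iy.                                                  *)
Definition complexification (A : Type) : Type := (A * A)%type.
HB.instance Definition _ (A : zmodType) := GRing.Zmodule.on (complexification A).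

Fact cplx_addE (A : zmodType) (u v : complexification A) :
  u + v = (u.1 + v.1, u.2 + v.2).
Proof. by []. Qed.

Section ComplexificationRing.
Context {A : pzRingType}.
Local Notation CC := (complexification A).

Definition cplx_one : CC := (1, 0).
Definition cplx_mul (u v : CC) : CC :=
  (u.1 * v.1 - u.2 * v.2, u.1 * v.2 + u.2 * v.1).

Fact cplx_mulA : associative cplx_mul.
Proof.
move=> [a a'] [b b'] [c c']; rewrite /cplx_mul /=.
rewrite !(mulrBl, mulrBr, mulrDl, mulrDr) !mulrA.
by congr (_, _); [apply: addr_aux1|apply: addr_aux2].
Qed.
Fact cplx_mul1l : left_id cplx_one cplx_mul.
Proof. by case=> a b; rewrite /cplx_mul /= !mul1r !mul0r subr0 addr0. Qed.
Fact cplx_mul1r : right_id cplx_one cplx_mul.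
Proof. by case=> a b; rewrite /cplx_mul /= !mulr1 !mulr0 subr0 add0r. Qed.
Fact cplx_mulDl : left_distributive cplx_mul +%R.
Proof.
move=> [a a'] [b b'] [c c']; rewrite !cplx_addE /cplx_mul /=.
by rewrite !mulrDl opprD addrACA [X in (_, X)]addrACA.
Qed.
Fact cplx_mulDr : right_distributive cplx_mul +%R.
Proof.
move=> [a a'] [b b'] [c c']; rewrite !cplx_addE /cplx_mul /=.
by rewrite !mulrDr opprD addrACA [X in (_, X)]addrACA.
Qed.

HB.instance Definition _ := GRing.Zmodule_isPzRing.Build CC
  cplx_mulA cplx_mul1l cplx_mul1r cplx_mulDl cplx_mulDr.

End ComplexificationRing.

Section ComplexificationModule.
Context {R : realType} {A : lmodType R}.
Local Notation CC := (complexification A).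

Definition cplx_scale (c : R[i]) (u : CC) : CC :=
  (complex.Re c *: u.1 - complex.Im c *: u.2,
   complex.Re c *: u.2 + complex.Im c *: u.1).

Fact cplx_scaleA a b u :
  cplx_scale a (cplx_scale b u) = cplx_scale (a * b) u.
Proof.
case: a b u => [a a'] [b b'] [x y]; rewrite /cplx_scale /=.
rewrite !scalerBr !scalerDr !scalerA !scalerBl !scalerDl.
by congr (_, _); [apply: addr_aux1|apply: addr_aux2].
Qed.
Fact cplx_scale1 : left_id 1 cplx_scale.
Proof. by case=> x y; rewrite /cplx_scale /= !scale1r !scale0r subr0 addr0. Qed.
Fact cplx_scaleDr : right_distributive cplx_scale +%R.
Proof.
move=> c [x x'] [y y']; rewrite !cplx_addE /cplx_scale /=.
by rewrite !scalerDr opprD addrACA [X in (_, X)]addrACA.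
Qed.
Fact cplx_scaleDl u : {morph cplx_scale^~ u : a b / a + b}.
Proof.
case: u => x x' [a a'] [b b']; rewrite !cplx_addE /cplx_scale /=.
by rewrite !scalerDl opprD addrACA [X in (_, X)]addrACA.
Qed.

HB.instance Definition _ := GRing.Zmodule_isLmodule.Build R[i] CC
  cplx_scaleA cplx_scale1 cplx_scaleDr cplx_scaleDl.

End ComplexificationModule.

Section Clifford.
Context {R : realType} {V : lmodType R}.

Fact malg_scalerAr (c : R) (x y : {malg R[{fmonom V}]}) :
  c *: (x * y) = x * (c *: y).
Proof.
apply/malgP => m; rewrite mcoeffZ mcoeffMl mulr_sumr.
rewrite (mcoeffMlw _ (fsubset_refl _) (msuppZ_le _ _)).
apply/eq_bigr => k _; rewrite mulr_sumr; apply/eq_bigr => l _.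
by rewrite mcoeffZ mulrnAr mulrCA.
Qed.

Definition free_alg : Type := {malg R[{fmonom V}]}.
HB.instance Definition _ := GRing.Lalgebra.on free_alg.
HB.instance Definition _ :=
  GRing.LSemiAlgebra_isSemiAlgebra.Build R free_alg malg_scalerAr.

Definition free_gen (v : V) : free_alg := << fmu v >>.

(* The tensor algebra, presented as the free algebra on the set V modulo the  *)
(* relations that make the inclusion of V linear.                             *)
Definition tensor_relations : set free_alg :=
  [set x | exists (a : R) (v w : V),
     x = free_gen (a *: v + w) - (a *: free_gen v + free_gen w)].

Definition tensor_alg : Type := alg_quot tensor_relations.
HB.instance Definition _ := GRing.Lmodule.on tensor_alg.
HB.instance Definition _ := GRing.PzRing.on tensor_alg.

Definition free_counit : free_alg -> R := @mcoeff (fmonom V) R mone.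

Fact free_counit_gen v : free_counit (free_gen v) = 0.
Proof.
rewrite /free_counit mcoeffU1; case: eqP => // /(congr1 (@fdeg V)).
by rewrite fdegU fdeg1.
Qed.

Fact free_counitB x y : free_counit (x - y) = free_counit x - free_counit y.
Proof. exact: mcoeffB. Qed.

Fact free_counitD x y : free_counit (x + y) = free_counit x + free_counit y.
Proof. exact: mcoeffD. Qed.

Fact free_counitM x y : free_counit (x * y) = free_counit x * free_counit y.
Proof. exact: (mcoeff1g_is_multiplicative _ _).1. Qed.

Fact free_counit1 : free_counit 1 = 1.
Proof. exact: (mcoeff1g_is_multiplicative _ _).2. Qed.

Fact free_counitZ c x : free_counit (c *: x) = c * free_counit x.
Proof. exact: mcoeffZ. Qed.

Fact tensor_alg_one_neq0 : (1 : tensor_alg) != 0.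
Proof.
pose K := [set x | free_counit x = 0].
have idK : two_sided_ideal K.
  split=> [|x y Kx Ky|a x Kx|a x Kx]; rewrite /K /mkset.
  - exact: mcoeff0.
  - by rewrite free_counitB Kx Ky subr0.
  - by rewrite free_counitM Kx mulr0.
  - by rewrite free_counitM Kx mul0r.
have relK : tensor_relations `<=` K.
  move=> _ [a [v [w ->]]].
  by rewrite /K /mkset free_counitB free_counitD free_counitZ !free_counit_gen mulr0 addr0 subrr.
apply/eqP; rewrite -(alg_quot_pi0 tensor_relations).
move=> /(alg_quot_piE tensor_relations 1 0).1 /(_ K idK relK).
by rewrite /K /mkset subr0 free_counit1 => /eqP; rewrite oner_eq0.
Qed.

HB.instance Definition _ :=
  GRing.PzSemiRing_isNonZero.Build tensor_alg tensor_alg_one_neq0.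
HB.instance Definition _ := GRing.LSemiModule_isLSemiAlgebra.Build R tensor_alg
  (@alg_quot_scalerAl R free_alg tensor_relations).
HB.instance Definition _ := GRing.LSemiAlgebra_isSemiAlgebra.Build R tensor_alg
  (@alg_quot_scalerAr R free_alg tensor_relations).

Definition tensor_gen (v : V) : tensor_alg :=
  alg_quot_pi tensor_relations (free_gen v).

Variable q : V -> R.

Definition clifford_relations : set tensor_alg :=
  [set x | exists v : V, x = tensor_gen v * tensor_gen v - q v *: 1].

Definition clifford : Type := alg_quot clifford_relations.
HB.instance Definition _ := GRing.Lmodule.on clifford.
HB.instance Definition _ := GRing.PzRing.on clifford.

Definition clifford_gen (v : V) : clifford :=
  alg_quot_pi clifford_relations (tensor_gen v).

Lemma clifford_scalerAl (c : R) (x y : clifford) : c *: (x * y) = (c *: x) * y.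
Proof. exact: alg_quot_scalerAl. Qed.
Lemma clifford_scalerAr (c : R) (x y : clifford) : c *: (x * y) = x * (c *: y).
Proof. exact: alg_quot_scalerAr. Qed.

Definition cclifford : Type := complexification clifford.
HB.instance Definition _ := GRing.PzRing.on cclifford.
HB.instance Definition _ := GRing.Lmodule.on cclifford.

Definition complexify (x : clifford) : cclifford := (x, 0).

End Clifford.

Arguments clifford {R V} q.
Arguments cclifford {R V} q.
Arguments clifford_gen {R V q} v.

Section QuadraticSpace.
Context {R : realType} {V : vectType R}.
Implicit Type q : V -> R.

Definition polar q (v w : V) : R := q (v + w) - q v - q w.

Definition quadratic_form q :=
  (forall (a : R) (v : V), q (a *: v) = a ^+ 2 * q v) /\
  (forall (a : R) (u v w : V), polar q (a *: u + v) w = a * polar q u w + polar q v w).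

Definition nondegenerate_form q :=
  forall v : V, (forall w : V, polar q v w = 0) -> v = 0.

Definition orthonormal_basis q n (e : n.-tuple V) :=
  [/\ basis_of fullv e,
      (forall i j : 'I_n, i != j -> polar q (tnth e i) (tnth e j) = 0)
    & (forall j : 'I_n, q (tnth e j) = 1 \/ q (tnth e j) = -1)].

(* The big product over 'I_n runs through the indices in increasing order.    *)
Definition clifford_basis q n (e : n.-tuple V) (I : {set 'I_n}) : cclifford q :=
  complexify (\prod_(j in I) clifford_gen (tnth e j)).

Definition gaussian_integer (z : R[i]) :=
  (complex.Re z \is a Num.int) && (complex.Im z \is a Num.int).

Definition integral_clifford q n (e : n.-tuple V) (h : cclifford q) :=
  exists2 c : {set 'I_n} -> R[i], (forall I, gaussian_integer (c I))
    & h = \sum_(I : {set 'I_n}) c I *: clifford_basis q e I.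

Definition int_clifford q n (e : n.-tuple V) : Type :=
  {h : cclifford q | integral_clifford e h}.

Definition star_involution q (star : cclifford q -> cclifford q) :=
  [/\ (forall u v, star (u + v) = star u + star v),
      (forall c u, star (c *: u) = (c^* )%R *: star u),
      (forall u v, star (u * v) = star v * star u)
    & (forall u, star (star u) = u)].

End QuadraticSpace.

Section SpinorModule.
Context {R : realType} {V : vectType R} (q : V -> R) {Delta : vectType R[i]}.

(* [{dot Delta for Num.conj}] is the type of positive definite Hermitian      *)
(* forms, linear in the first argument. The dimension is a consequence of the *)
(* isomorphism and is recorded as part of the definition.                     *)
Record unitary_spinor_module (k : nat) (star : cclifford q -> cclifford q)
    (Delta0 Delta1 : {vspace Delta}) (H : {dot Delta for Num.conj})
    (rho : cclifford q -> 'End(Delta)) : Prop := UnitarySpinorModule {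
  spinor_grading_sum : (Delta0 + Delta1)%VS = fullv;
  spinor_grading_direct : (Delta0 :&: Delta1)%VS = 0%VS;
  spinor_dim : \dim {: Delta} = (2 ^ k)%N;
  spinor_linear : linear rho;
  spinor_one : rho 1 = \1%VF;
  spinor_mul : forall g h, rho (g * h) = (rho g \o rho h)%VF;
  spinor_bij : bijective rho;
  spinor_adjoint : forall g x y, H (rho g x) y = H x (rho (star g) y)
}.

End SpinorModule.

(* A finite dimensional vector space carries no canonical topology in the     *)
(* library, so neighbourhoods and (Frechet) differentiability are read in the *)
(* linear coordinates [v2r : W -> 'rV_(dim W)].                               *)
Section Coordinates.
Context {K : numFieldType} {W : vectType K}.

Definition eventually_near (v : W) (P : W -> Prop) :=
  \forall x \near v2r v, P (r2v x).

Definition differentiable_near (v : W) (g : W -> W) :=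
  \forall x \near v2r v, differentiable (v2r \o g \o r2v) x.

Lemma linear_differentiable_near v (F : 'End(W)) : differentiable_near v F.
Proof.
apply: filterE => x.
have -> : v2r \o F \o r2v = \sum_(i < dim W)
    (fun y : 'rV[K]_(dim W) => y 0 i *: v2r (F (r2v (delta_mx 0 i)))).
  apply/funext => y; rewrite fct_sumE /= [in LHS](row_sum_delta y) !linear_sum /=.
  by apply: eq_bigr => i _; rewrite !linearZ.
apply: differentiable_sum => i; apply: differentiableZl.
exact: differentiable_coord.
Qed.

Lemma eventually_nearE v (P : W -> Prop) : (forall x, P x) -> eventually_near v P.
Proof. by move=> Px; rewrite /eventually_near; apply: filterE => x; apply: Px. Qed.

End Coordinates.

Section ComplexTorus.
Context {R : realType} {W : vectType R[i]}.

(* b is a basis of W as a real vector space, and Gamma is its integer span.   *)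
Definition lattice_basis (Gamma : {pred W}) (b : 'I_(2 * \dim {: W}) -> W) :=
  (forall c : 'I_(2 * \dim {: W}) -> R,
      \sum_i (c i)%:C *: b i = 0 -> forall i, c i = 0) /\
  (forall w, w \in Gamma <-> exists z : 'I_(2 * \dim {: W}) -> int,
      w = \sum_i b i *~ z i).

Definition full_rank_lattice (Gamma : {pred W}) := exists b, lattice_basis Gamma b.

Context (Gamma : zmodClosed W).

Definition torus : Type := Quotient.quot Gamma.
HB.instance Definition _ := EqQuotient.on torus.
HB.instance Definition _ := GRing.Zmodule.on torus.

Definition torus_pi (w : W) : torus := \pi_torus w.

(* The charts of W / Gamma are the local inverses of [torus_pi], so f is      *)
(* holomorphic when locally it lifts to holomorphic maps W -> W.              *)
Definition torus_holomorphic (f : torus -> torus) :=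
  forall v : W, exists2 g : W -> W, differentiable_near v g
    & eventually_near v (fun x => f (torus_pi x) = torus_pi (g x)).

Record torus_end := TorusEnd {
  torus_fun :> {additive torus -> torus};
  torus_endP : torus_holomorphic torus_fun
}.

Definition analytic_lift (f : torus_end) (F : 'End(W)) :=
  (forall w, w \in Gamma -> F w \in Gamma) /\
  (forall w, f (torus_pi w) = torus_pi (F w)).

(* The linear map inducing f; it exists and is unique when Gamma is a full    *)
(* rank lattice, and 0 is only the default value of [xget].                   *)
Definition tau_a (f : torus_end) : 'End(W) := xget 0 [set F | analytic_lift f F].

Section Induced.
Variable F : 'End(W).
Hypothesis FG : forall w, w \in Gamma -> F w \in Gamma.

Definition induced_fun (x : torus) : torus := torus_pi (F (repr x)).

Lemma torus_piE x y : torus_pi x = torus_pi y <-> x - y \in Gamma.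
Proof. by split=> [/eqmodP|xy]; last apply/eqmodP. Qed.

Lemma torus_piB : {morph torus_pi : x y / x - y}.
Proof. by move=> x y; rewrite /torus_pi !piE. Qed.

Lemma induced_fun_pi w : induced_fun (torus_pi w) = torus_pi (F w).
Proof.
apply/torus_piE; rewrite -linearB; apply: FG; apply/torus_piE.
exact: reprK.
Qed.

Fact induced_fun_additive : zmod_morphism induced_fun.
Proof.
elim/quotW => x; elim/quotW => y.
rewrite -[\pi x]/(torus_pi x) -[\pi y]/(torus_pi y).
by rewrite -torus_piB !induced_fun_pi linearB torus_piB.
Qed.

HB.instance Definition _ :=
  GRing.isZmodMorphism.Build torus torus induced_fun induced_fun_additive.

Fact induced_fun_holomorphic : torus_holomorphic induced_fun.
Proof.
move=> v; exists F; first exact: linear_differentiable_near.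
by apply: eventually_nearE => x; apply: induced_fun_pi.
Qed.

Definition induced_end : torus_end := TorusEnd induced_fun_holomorphic.

End Induced.

End ComplexTorus.

Section SpinorTorus.
Context {R : realType} {V : vectType R} {q : V -> R} {n : nat} (e : n.-tuple V).
Context {Delta : vectType R[i]} (rho : cclifford q -> 'End(Delta)).
Context (Gamma : zmodClosed Delta).

Definition integral_stable :=
  forall h : int_clifford q e, forall w, w \in Gamma -> rho (sval h) w \in Gamma.

Definition rho_hat (stab : integral_stable) (h : int_clifford q e) :
    torus_end Gamma := induced_end (stab h).

Definition principal_polarization (H : Delta -> Delta -> R[i]) :=
  (forall x y, x \in Gamma -> y \in Gamma -> complex.Im (H x y) \is a Num.int) /\
  (exists2 b, lattice_basis Gamma b &
     \det (\matrix_(i, j) complex.Im (H (b i) (b j))) = 1).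

End SpinorTorus.

(* Main.v *)
Require Import Defs.
From mathcomp Require Import all_boot all_order all_algebra.
From mathcomp Require Import complex sesquilinear reals.
From mathcomp Require Import boolp classical_sets.

Local Open Scope ring_scope.
Local Open Scope complex_scope.

Import GRing.Theory Num.Theory.

(** Two linear lifts of the same endomorphism of W / Gamma differ by a linear
    map D with values in Gamma. If D w had a nonzero coordinate z in a basis of
    the lattice, then D (w / (2 z)) would have the coordinate 1 / 2 there, which
    is not an integer; hence D = 0 and the lift is unique. *)

Section Lattice.
Context {R : realType} {W : vectType R[i]}.

(** Independence of [b] over the reals suffices: the differences [z j - z' j], read as real numbers,
    are the coefficients of a vanishing combination. *)
Lemma lattice_coord_inj (Gamma : {pred W}) b (z z' : 'I_(2 * \dim {: W}) -> int) :
    lattice_basis Gamma b ->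
  \sum_i b i *~ z i = \sum_i b i *~ z' i -> forall i, z i = z' i.
Proof.
move=> [b_free _] eq_zz' i; apply/eqP.
rewrite -subr_eq0 -(intr_eq0 R); apply/eqP.
apply: (b_free (fun j => (z j - z' j)%:~R)).
rewrite -[RHS](subrr (\sum_i b i *~ z' i)) -{1}eq_zz' -sumrB.
by apply: eq_bigr => j _; rewrite rmorph_int scaler_int mulrzBr.
Qed.

Lemma linear_into_lattice_eq0 (Gamma : {pred W}) (D : 'End(W)) :
  full_rank_lattice Gamma -> (forall w, D w \in Gamma) -> D = 0.
Proof.
move=> [b bG] DG; apply/lfunP => w; rewrite zero_lfunE.
have [z Dw] := (bG.2 _).1 (DG w).
suff z0 i : z i = 0 by rewrite Dw big1 // => i _; rewrite z0 mulr0z.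
apply/eqP; apply: contraT => zi0.
have N0 : (z i * 2)%:~R != 0 :> R[i] by rewrite intr_eq0 mulf_neq0.
have [z' Dw'] := (bG.2 _).1 (DG ((z i * 2)%:~R^-1 *: w)).
(* Scaling back by [z i * 2] gives [D w] a second integer expansion, to be compared with [z]. *)
have /(lattice_coord_inj _ _ _ _ bG)/(_ i) :
    \sum_j b j *~ z j = \sum_j b j *~ (z' j * (z i * 2)).
  rewrite -Dw -[w in LHS](scalerKV N0) linearZ /= Dw' scaler_int mulrz_suml.
  by apply: eq_bigr => j _; rewrite -mulrzA.
(* Cancelling [z i] leaves [1 = z' i * 2], which parity refutes. *)
rewrite mulrCA -{1}[z i]mulr1 => /(mulfI zi0)/(congr1 (fun x => odd `|x|%N)).
by rewrite abszM oddM andbF.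
Qed.

(** Both [F w] and [G w] represent the class [f (torus_pi w)], so [F - G] takes its values in
    [Gamma]. *)
Lemma analytic_lift_inj (Gamma : zmodClosed W) (f : torus_end Gamma) (F G : 'End(W)) :
  full_rank_lattice Gamma -> analytic_lift f F -> analytic_lift f G -> F = G.
Proof.
move=> GammaL [_ fF] [_ fG]; apply/eqP; rewrite -subr_eq0; apply/eqP.
apply: linear_into_lattice_eq0 GammaL _ => w.
by rewrite !lfunE /= opp_lfunE; apply/torus_piE; rewrite -fF -fG.
Qed.

(** Since a lift exists, [xget] returns a lift and not its default 0; uniqueness identifies it with
    [F]. *)
Lemma tau_a_lift (Gamma : zmodClosed W) (f : torus_end Gamma) (F : 'End(W)) :
  full_rank_lattice Gamma -> analytic_lift f F -> tau_a f = F.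
Proof.
by move=> GammaL fF; apply: xget_unique => // G /analytic_lift_inj; apply.
Qed.

End Lattice.

Theorem lemma3p18 (R : realType) (k : nat) (V : vectType R) (q : V -> R)
    (dimV : \dim {: V} = (2 * k)%N)
    (q_quadratic : quadratic_form q) (q_nondegenerate : nondegenerate_form q)
    (e : (2 * k).-tuple V) (e_orthonormal : orthonormal_basis q e)
    (star : cclifford q -> cclifford q) (star_inv : star_involution star)
    (Delta : vectType R[i]) (Delta0 Delta1 : {vspace Delta})
    (H : {dot Delta for Num.conj}) (rho : cclifford q -> 'End(Delta))
    (spinor : unitary_spinor_module k star Delta0 Delta1 H rho)
    (Gamma : zmodClosed Delta) (Gamma_lattice : full_rank_lattice Gamma)
    (Gamma_stable : integral_stable e rho Gamma)
    (H_polarization : principal_polarization Gamma H) :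
  forall h : int_clifford q e, tau_a (rho_hat Gamma_stable h) = rho (sval h).
Proof.
move=> h; apply: (tau_a_lift _ _ _ Gamma_lattice).
(* [rho (sval h)] is itself a lift: it preserves [Gamma], and [rho_hat] is the map it induces on the
   quotient. *)
split=> [|w]; first exact: Gamma_stable.
exact: (induced_fun_pi (Gamma_stable h)).
Qed.
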